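(* Let $A=\mathbb{F}Q/I$ be the radical square zero Nakayama algebra with $n$ vertices, i.e. $Q$ is the linearly oriented quiver $1\to2\to\cdots\to n$ and $I$ is the ideal generated by all paths of length two. Then the number of exceptional pairs of $A$ is \[ \frac{7n^2-17n+12}{2}. \]
   Context: $\mathbb{F}$ is an algebraically closed field and $n\ge 3$. Modules are finite-dimensional and identified with finite-dimensional representations of $Q$ (linear maps $V_i\to V_{i+1}$) satisfying the relations in $I$. A pair $(M,N)$ of $A$-modules is an exceptional pair if $\operatorname{Hom}_A(N,M)\cong 0$ and $\operatorname{Ext}^i_A(N,M)\cong 0$ for all $i\ge 1$. The number of exceptional pairs is the number of ordered pairs $(M,N)$ of isomorphism classes of indecomposable modules that are exceptional pairs. *)

(* Defs.v *)
From HB Require Import structures.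
From mathcomp Require Import all_boot all_order all_algebra.

Set Implicit Arguments.
Unset Strict Implicit.
Unset Printing Implicit Defensive.

Import GRing.Theory.
Local Open Scope ring_scope.

Record quiver : Type := Quiver {
  vertex :> finType;
  arrow : vertex -> vertex -> Type
}.

(* 1 -> 2 -> ... -> n, with the vertices numbered from 0 as in 'I_n. *)
Definition linear_quiver (n : nat) : quiver :=
  @Quiver 'I_n (fun i j => val j = (val i).+1).

(* A finite-dimensional module over FQ/I, where I is the ideal generated by
   all paths of length two, seen as a finite-dimensional representation of Q
   satisfying the relations in I. *)
Record module (F : fieldType) (Q : quiver) : Type := Module {
  space_at :> Q -> vectType F;
  act : forall i j : Q, arrow i j -> 'Hom(space_at i, space_at j);
  act_path2 : forall (i j k : Q) (a : arrow i j) (b : arrow j k),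
    (act b \o act a)%VF = 0
}.

Section Modules.

Variables (F : fieldType) (Q : quiver).
Implicit Types M N P X Y : module F Q.

Record morphism M N : Type := Morphism {
  map_at :> forall i : Q, 'Hom(M i, N i);
  map_atP : forall (i j : Q) (a : arrow i j),
    (map_at j \o act M a)%VF = (act N a \o map_at i)%VF
}.

Definition surjective_morphism M N (f : morphism M N) : Prop :=
  forall i, limg (f i) = fullv.

Definition exact_at X M Y (f : morphism X M) (g : morphism M Y) : Prop :=
  forall i, limg (f i) = lker (g i).

Definition isomorphic M N : Prop :=
  exists (f : morphism M N) (g : morphism N M),
    forall i, (g i \o f i)%VF = \1%VF /\ (f i \o g i)%VF = \1%VF.

Definition submodule M (U : forall i : Q, {vspace (M i)}) : Prop :=
  forall (i j : Q) (a : arrow i j), (act M a @: U i <= U j)%VS.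

Definition zero_submodule M (U : forall i : Q, {vspace (M i)}) : Prop :=
  forall i, U i = 0%VS.

Definition indecomposable M : Prop :=
  (exists i : Q, \dim (fullv : {vspace (M i)}) != 0%N) /\
  forall U W : forall i : Q, {vspace (M i)},
    submodule U -> submodule W ->
    (forall i, (U i + W i)%VS = fullv /\ (U i :&: W i)%VS = 0%VS) ->
    zero_submodule U \/ zero_submodule W.

Definition projective P : Prop :=
  forall X Y (p : morphism X Y) (f : morphism P Y),
    surjective_morphism p ->
    exists g : morphism P X, forall i, (p i \o g i)%VF = f i.

(* ... -> P_2 -> P_1 -> P_0 -> N -> 0, with res_diff k : P_(k+1) -> P_k. *)
Record projective_resolution N : Type := ProjectiveResolution {
  res :> nat -> module F Q;
  res_diff : forall k : nat, morphism (res k.+1) (res k);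
  res_aug : morphism (res 0) N;
  res_projective : forall k, projective (res k);
  res_aug_surjective : surjective_morphism res_aug;
  res_exact_aug : exact_at (res_diff 0) res_aug;
  res_exact : forall k, exact_at (res_diff k.+1) (res_diff k)
}.

Definition cocycle N (P : projective_resolution N) M (k : nat)
    (f : morphism (P k) M) : Prop :=
  forall i, (f i \o res_diff P k i)%VF = 0.

Definition coboundary N (P : projective_resolution N) M (k : nat) :
    morphism (P k) M -> Prop :=
  match k return morphism (P k) M -> Prop with
  | 0 => fun f => forall i, f i = 0
  | l.+1 => fun f => exists g : morphism (P l) M,
                       forall i, f i = (g i \o res_diff P l i)%VF
  end.

(* Ext^k(N, M) = 0: Ext^k(N, M) is the k-th cohomology of Hom(P, M) for a
   projective resolution P of N.  It does not depend on P up to isomorphism,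
   and over the linear quivers every module has a resolution, so quantifying
   over all P amounts to choosing one. *)
Definition Ext_zero (k : nat) N M : Prop :=
  forall (P : projective_resolution N) (f : morphism (P k) M),
    cocycle f -> coboundary f.

Definition Hom_zero N M : Prop :=
  forall (f : morphism N M) (i : Q), f i = 0.

(* Note the order: morphisms and extensions go from N to M. *)
Definition exceptional_pair M N : Prop :=
  Hom_zero N M /\ forall k : nat, (1 <= k)%N -> Ext_zero k N M.

(* There are exactly m ordered pairs of isomorphism classes of indecomposable
   modules that are exceptional pairs: (R a)_(a < m) is an irredundant and
   complete list of representatives. *)
Definition number_of_exceptional_pairs (m : nat) : Prop :=
  exists R : 'I_m -> module F Q * module F Q,
    [/\ forall a, [/\ indecomposable (R a).1, indecomposable (R a).2
                    & exceptional_pair (R a).1 (R a).2],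
        forall a b, isomorphic (R a).1 (R b).1 ->
                    isomorphic (R a).2 (R b).2 -> a = b
      & forall M N, indecomposable M -> indecomposable N ->
                    exceptional_pair M N ->
                    exists a, isomorphic M (R a).1 /\ isomorphic N (R a).2].

End Modules.

(* Main.v *)
Require Import Defs.
From HB Require Import structures.
From mathcomp Require Import all_boot all_order all_algebra.
From mathcomp Require Import zify lra.

(** Representations of 1 -> 2 -> ... -> n in which every composite of two arrows
    vanishes are cochain complexes of length n, and this is how the proof reads
    them.  The 2n - 1 indecomposables are the complexes F in one place (the
    simple modules S_a) and F = F in two consecutive places (modules P_a that are
    both projective and injective, for a < n - 1); here they are [thin a false] and
    [thin a true], with vertices numbered from 0.

    Classification ([indecomposable_isomorphic]): if some arrow of M does not
    kill y in M_a, then y generates a copy of P_a, which splits off because P_a is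
    injective; if all arrows vanish, any nonzero vector generates a simple direct
    summand.

    Exceptional pairs (M, N) ([exceptional_thinP]).
    - M = P_a is injective, with Hom(N, P_a) dual to N_(a+1), so the condition is
      N_(a+1) = 0.
    - M = S_a and N = P_b: Hom(P_b, M) = M_b, so b <> a is necessary.
    - M = S_a and N = S_b: S_b has the resolution ... -> P_(b+1) -> P_b -> S_b, so
      Ext^k(S_b, S_a) is nonzero for k = a - b >= 0, and a < b is necessary.
    In the last two cases the condition is also sufficient, since N is then an
    exact complex at every vertex before a, and this forces Ext^k(N, S_a) = 0 for
    all k >= 1 ([Ext_simple_zero]).  That step must deal with an arbitrary projective
    resolution R of N.  Each R_k is exact, as a complex, at every vertex except the
    last ([projective_exact]), so R is a double complex with exact rows and columns
    in the relevant range.  A staircase argument ([top_exact_step]) then shows that R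
    remains exact at vertex a after dividing every R_k by its radical, and this is
    exactly the complex on which Hom(R, S_a) depends.

    Summing the three conditions gives
    3 (n - 1)^2 - (2n - 3) + n (n - 1) / 2 = (7 n^2 - 17 n + 12) / 2. *)

Set Implicit Arguments.
Unset Strict Implicit.
Unset Printing Implicit Defensive.

Import GRing.Theory.
Local Open Scope ring_scope.

(** * Linear maps *)

Lemma lpreimK_sub (F : fieldType) (V W : vectType F) (f : 'Hom(V, W)) x :
  x - (f^-1)%VF (f x) \in lker f.
Proof. by rewrite memv_ker linearB /= limg_lfunVK ?subrr // memv_img ?memvf. Qed.

Section Linear.

Variables (F : fieldType) (V V' W : vectType F).

(** Factoring f through d and the quotient by U: the hypothesis says that f kills
    the kernel of V -> V' -> V'/U. *)
Lemma factor_lfun (f : 'Hom(V, W)) (d : 'Hom(V, V')) (U : {vspace V'}) :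
    (forall x, d x \in U -> f x = 0) ->
  exists g : 'Hom(V', W), (g \o d)%VF = f /\ (U <= lker g)%VS.
Proof.
move=> fU.
(* p stands for the quotient map by U: it is a projection with kernel U. *)
pose p : 'Hom(V', V') := \1%VF - projv U.
have pU y : p y \in U -> y \in U.
  rewrite add_lfunE opp_lfunE id_lfunE => /memvD/(_ (memv_proj U y)).
  by rewrite subrK.
exists (f \o (p \o d)^-1 \o p)%VF; split.
  apply/lfunP => x; rewrite !comp_lfunE; apply/eqP.
  rewrite eq_sym -subr_eq0 -linearB /=.
  have := lpreimK_sub (p \o d)%VF x; rewrite memv_ker !comp_lfunE /= => /eqP pd0.
  by apply/eqP/fU/pU; rewrite pd0 mem0v.
apply/subvP => y yU; rewrite memv_ker !comp_lfunE add_lfunE opp_lfunE id_lfunE.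
by rewrite projv_id // subrr !linear0.
Qed.

(** For d = 1 this is the linear map sending 1 to x.  It is stated for every d
    because the spaces of a thin module have dimension 0 or 1 according to a boolean
    that does not reduce. *)
Definition ray_fun d (x : V) (t : 'rV[F]_d) : V := (\sum_k t 0 k) *: x.

Lemma ray_fun_is_linear d x : linear (@ray_fun d x).
Proof.
move=> a s t; rewrite /ray_fun scalerA mulr_sumr -scalerDl -big_split /=.
by congr (_ *: _); apply: eq_bigr => k _; rewrite !mxE.
Qed.
HB.instance Definition _ d x :=
  GRing.isLinear.Build F 'rV[F]_d V _ (@ray_fun d x) (@ray_fun_is_linear d x).

Definition ray d x : 'Hom('rV[F]_d, V) := linfun (@ray_fun d x).

Lemma ray1 d x : ray d x (const_mx 1) = d%:R *: x.
Proof.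
rewrite lfunE /= /ray_fun; congr (_ *: _).
by rewrite (eq_bigr (fun=> 1)) => [|k _]; rewrite ?mxE // sumr_const card_ord.
Qed.

End Linear.

Lemma lfun_exists (F : fieldType) (V W : vectType F) (x : V) (w : W) :
  x != 0 -> exists h : 'Hom(V, W), h x = w.
Proof.
move=> x0.
have xw (t : 'rV[F]_1) : ray 1 x t \in 0%VS -> ray 1 w t = 0.
  rewrite memv0 !lfunE /= /ray_fun scaler_eq0 (negPf x0) orbF => /eqP ->.
  by rewrite scale0r.
have [h [hx _]] := factor_lfun xw; exists h.
by have /lfunP/(_ (const_mx 1)) := hx; rewrite comp_lfunE !ray1 !scale1r.
Qed.

Lemma lfun_rV1 (F : fieldType) (V : vectType F) (b : bool)
    (f g : 'Hom('rV[F]_b, V)) :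
  f (const_mx 1) = g (const_mx 1) -> f = g.
Proof.
move=> fg; apply/lfunP => t.
case: b f g fg t => f g fg t; last by rewrite (thinmx0 t) !linear0.
have -> : t = t 0 0 *: const_mx 1; last by rewrite !linearZ /= fg.
by apply/rowP => k; rewrite !mxE ord1 mulr1.
Qed.

(** * Modules as cochain complexes *)

Section Modules.

Variables (F : fieldType) (n : nat).
Local Notation Q := (linear_quiver n).
Implicit Types (L M N P : module F Q) (i j k : 'I_n).

(** The action of the arrow i -> j if there is one, and 0 otherwise.  Being total, it
    frees the statements from proofs that i -> j is an arrow. *)
Definition edge M i j : 'Hom(M i, M j) :=
  if nat_of_ord j =P (nat_of_ord i).+1 is ReflectT a then @act F Q M i j a else 0.

Lemma edgeE M i j (a : j = i.+1 :> nat) : @act F Q M i j a = edge M i j.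
Proof.
by rewrite /edge; case: eqP => // a'; congr act; apply: eq_irrelevance.
Qed.

Lemma edge0 M i j : j != i.+1 :> nat -> edge M i j = 0.
Proof. by rewrite /edge; case: eqP. Qed.

Lemma edge_edge M i j k x : edge M j k (edge M i j x) = 0.
Proof.
have [a|/eqP a] := nat_of_ord j =P i.+1; last first.
  by rewrite (edge0 _ a) zero_lfunE linear0.
have [b|/eqP b] := nat_of_ord k =P j.+1; last first.
  by rewrite (edge0 _ b) zero_lfunE.
by rewrite -(edgeE M a) -(edgeE M b) -comp_lfunE act_path2 zero_lfunE.
Qed.

Lemma map_edge M N (f : morphism M N) i j x :
  f j (edge M i j x) = edge N i j (f i x).
Proof.
have [a|/eqP a] := nat_of_ord j =P i.+1; last first.
  by rewrite !(edge0 _ a) !zero_lfunE linear0.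
by rewrite -!(edgeE _ a) -!comp_lfunE map_atP.
Qed.

Definition commutes M N (f : forall i, 'Hom(M i, N i)) : Prop :=
  forall i j, j = i.+1 :> nat ->
  forall x, f j (edge M i j x) = edge N i j (f i x).

Lemma commutesP M N (f : forall i, 'Hom(M i, N i)) :
  commutes f ->
  forall (i j : Q) (a : arrow i j), (f j \o act M a = act N a \o f i)%VF.
Proof. by move=> cf i j a; apply/lfunP => x; rewrite !comp_lfunE !edgeE cf. Qed.

Definition morphism_of M N (f : forall i, 'Hom(M i, N i)) (cf : commutes f) :
    morphism M N :=
  Morphism (commutesP cf).

Lemma comp_commutes L M N (g : morphism M N) (f : morphism L M) :
  commutes (fun i => (g i \o f i)%VF).
Proof. by move=> i j _ x; rewrite !comp_lfunE !map_edge. Qed.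

Definition comp L M N (g : morphism M N) (f : morphism L M) : morphism L N :=
  morphism_of (comp_commutes g f).

Lemma zero_commutes M N : commutes (fun i => 0 : 'Hom(M i, N i)).
Proof. by move=> i j _ x; rewrite !zero_lfunE linear0. Qed.

Definition zero_morphism M N : morphism M N := morphism_of (@zero_commutes M N).

(** * Thin modules *)

Definition supp a (e : bool) v : bool := (a <= v <= a + e)%N.

Lemma supp_path a e v :
  supp a e v.+2 -> (supp a e v * supp a e v.+1)%N = 0%N.
Proof. by rewrite /supp; case: e => /=; lia. Qed.

Definition thin_act a e (i j : Q) (_ : arrow i j) :
    'Hom('rV[F]_(supp a e i), 'rV[F]_(supp a e j)) :=
  ray _ (const_mx 1).

Lemma thin_act_path2 a e (i j k : Q) (u : arrow i j) (v : arrow j k) :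
  (thin_act a e v \o thin_act a e u)%VF = 0.
Proof.
apply: lfun_rV1; rewrite comp_lfunE zero_lfunE !ray1 !linearZ /= ray1 !scalerA -!natrM.
have := @supp_path a e i.
rewrite -(u : val j = (val i).+1) -(v : val k = (val j).+1).
case: (supp a e k) => [-> //|_]; first by rewrite scale0r.
exact: (etrans (thinmx0 _)).
Qed.

(** The module with a copy of F at each vertex of [a, a + e] and identities between
    them.  The index a is any natural number, so the module is zero when n <= a: this
    lets minimal resolutions of simple modules be written without a case distinction
    at the last vertex. *)
Definition thin a e : module F Q :=
  Module (space_at := fun v : Q => 'rV[F]_(supp a e v) : vectType F)
    (@thin_act_path2 a e).

Definition gen a e i : thin a e i := const_mx 1 : 'rV[F]_(supp a e i).

Lemma edge_gen a e i j :
  j = i.+1 :> nat ->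
  edge (thin a e) i j (gen a e i) = (supp a e i)%:R *: gen a e j.
Proof. by move=> ij; rewrite -(edgeE _ ij) /= ray1. Qed.

Lemma edge_gen1 a e i j : j = i.+1 :> nat -> supp a e i ->
  edge (thin a e) i j (gen a e i) = gen a e j.
Proof. by move=> ij si; rewrite edge_gen // {1}si scale1r. Qed.

Lemma thin0 a e i : ~~ supp a e i -> forall x : thin a e i, x = 0.
Proof.
rewrite /thin /=; case: (supp a e i) => // _ x; exact: (etrans (thinmx0 _)).
Qed.

Lemma gen_neq0 a e i : supp a e i -> gen a e i != 0.
Proof.
move=> si; apply/eqP => /matrixP g0.
have k0 : (0 < supp a e i)%N by rewrite si.
by have /eqP := g0 0 (Ordinal k0); rewrite !mxE oner_eq0.
Qed.

Lemma thin_gen a e i (x : thin a e i) : exists c, x = c *: gen a e i.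
Proof.
rewrite /gen; move: x; rewrite /thin /=; case: (supp a e i) => x; last first.
  by exists 0; rewrite scale0r; exact: (etrans (thinmx0 _)).
by exists (x 0 0); apply/rowP => k; rewrite !mxE ord1 mulr1.
Qed.

Lemma limg_gen M a e i (f : 'Hom(M i, thin a e i)) :
  (supp a e i -> gen a e i \in limg f) -> limg f = fullv.
Proof.
move=> fg; apply/eqP; rewrite eqEsubv subvf; apply/subvP => y _.
have [c ->] := thin_gen y; apply: memvZ.
by have [/fg //|/thin0 z] := boolP (supp a e i); rewrite [gen _ _ _]z mem0v.
Qed.

Lemma eq_on_gen a e i (V : vectType F) (f g : 'Hom(thin a e i, V)) :
  f (gen a e i) = g (gen a e i) -> f = g.
Proof. exact: lfun_rV1. Qed.

Lemma thin_edge_inj a e i j (x : thin a e i) : j = i.+1 :> nat ->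
  supp a e j -> edge (thin a e) i j x = 0 -> x = 0.
Proof.
move=> ij sj; have [si|/thin0//] := boolP (supp a e i).
have [c ->] := thin_gen x; rewrite linearZ /= edge_gen1 // => /eqP.
by rewrite scaler_eq0 (negPf (gen_neq0 sj)) orbF => /eqP ->; rewrite scale0r.
Qed.

Lemma thin_edge_surj a e i j (x : thin a e j) : j = i.+1 :> nat ->
  supp a e i -> x \in limg (edge (thin a e) i j).
Proof.
move=> ij si; have [c ->] := thin_gen x.
have -> : c *: gen a e j = edge (thin a e) i j (c *: gen a e i).
  by rewrite linearZ /= edge_gen1 //.
by rewrite memv_img ?memvf.
Qed.

(** ** Morphisms to and from thin modules *)

Section FromThin.
Variables (a : nat) (e : bool) (M : module F Q) (x : forall i, M i).
Hypothesis edge_x : forall i j, j = i.+1 :> nat -> supp a e i ->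
  edge M i j (x i) = (supp a e j)%:R *: x j.

Definition from_thin_at i : 'Hom(thin a e i, M i) := @ray F (M i) (supp a e i) (x i).

Lemma from_thin_at_gen i : from_thin_at i (gen a e i) = (supp a e i)%:R *: x i.
Proof. exact: ray1. Qed.

Lemma from_thin_at_gen1 i : supp a e i -> from_thin_at i (gen a e i) = x i.
Proof. by move=> si; rewrite from_thin_at_gen {1}si scale1r. Qed.

Lemma from_thin_commutes : commutes from_thin_at.
Proof.
move=> i j ij y; have [c ->] := thin_gen y; rewrite !linearZ /= edge_gen // linearZ /=.
rewrite !from_thin_at_gen linearZ /=.
have [si|_] := boolP (supp a e i); last by rewrite !scale0r linear0 scaler0.
by rewrite !scale1r edge_x.
Qed.

Definition from_thin : morphism (thin a e) M := morphism_of from_thin_commutes.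

End FromThin.

(** Hom(P_a, M) = M_a, surjectivity: the generator at a may go to any vector. *)
Lemma projective_map (a : 'I_n) M (x : M a) :
  exists g : morphism (thin a true) M, g a (gen a true a) = x.
Proof.
pose y : forall i, M i := dfwith (fun i => edge M a i x) x.
have Hy i j : j = i.+1 :> nat -> supp a true i ->
    edge M i j (y i) = (supp a true j)%:R *: y j.
  move=> ij; rewrite /y /supp ij; have [ai|ia] := eqVneq a i.
    subst i; rewrite dfwith_in dfwith_out; last by apply/eqP => /(congr1 val) /=; lia.
    by move=> _; rewrite (_ : (_ <= _ <= _)%N = true) ?scale1r //=; lia.
  rewrite dfwith_out // edge_edge => si.
  have ian : a != i :> nat by [].
  rewrite (_ : (_ <= _ <= _)%N = false) ?scale0r //; apply/negbTE/negP => /=.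
  by move: si ian; rewrite /=; lia.
exists (from_thin Hy); rewrite /= from_thin_at_gen /y dfwith_in.
by rewrite /supp leqnn leq_addr scale1r.
Qed.

(** Hom(P_a, M) = M_a, injectivity: P_a is generated by its vector at a. *)
Lemma projective_map_unique (a : 'I_n) M (f g : morphism (thin a true) M) :
  f a (gen a true a) = g a (gen a true a) -> forall i, f i = g i.
Proof.
move=> fg i; apply: eq_on_gen; have [<-//|ia] := eqVneq a i.
have [si|/thin0 z] := boolP (supp a true i); last first.
  by rewrite (z (gen _ _ _)) !linear0.
have ian : a != i :> nat by [].
have ij : i = a.+1 :> nat by move: si ian; rewrite /supp /=; lia.
have -> : gen a true i = edge (thin a true) a i (gen a true a).
  by rewrite edge_gen1 // /supp leqnn leq_addr.
by rewrite !map_edge fg.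
Qed.

(** Hom(L, P_a) is dual to L_(a+1), surjectivity: the arrow of P_a is invertible, so a
    map h at its last vertex w = a + 1 determines the map at a. *)
Lemma injective_map a (w : 'I_n) L (h : 'Hom(L w, thin a true w)) : w = a.+1 :> nat ->
  exists g : morphism L (thin a true), g w = h.
Proof.
move=> wa; pose T := thin a true.
pose g : forall i, 'Hom(L i, T i) :=
  dfwith (fun i => ((edge T i w)^-1 \o h \o edge L i w)%VF) h.
have cg : commutes g.
  move=> i j ij x; rewrite /g; have [wj|wj] := eqVneq w j.
    subst j; rewrite dfwith_in dfwith_out; last by apply/eqP => /(congr1 val) /=; lia.
    rewrite !comp_lfunE limg_lfunVK // thin_edge_surj // /supp; move: wa ij; cbn; lia.
  rewrite [LHS](_ : _ = 0); last first.
    by rewrite dfwith_out // !comp_lfunE edge_edge !linear0.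
  have [sj|/thin0 z] := boolP (supp a true j); last by rewrite [RHS]z.
  rewrite [X in edge _ _ _ X](_ : _ = 0) ?linear0 //; apply: thin0.
  have: w != j :> nat by [].
  by move: sj ij wa; rewrite /supp /=; lia.
by exists (morphism_of cg); rewrite /= /g dfwith_in.
Qed.

(** Hom(L, P_a) is dual to L_(a+1), injectivity: P_a is cogenerated by its space at
    w = a + 1. *)
Lemma injective_map_unique a (w : 'I_n) L (f g : morphism L (thin a true)) :
  w = a.+1 :> nat -> f w = g w -> forall i, f i = g i.
Proof.
move=> wa fg i; have [<-//|wi] := eqVneq w i; apply/lfunP => x.
have [si|/thin0 z] := boolP (supp a true i); last by rewrite [LHS]z [RHS]z.
have: w != i :> nat by [].
move=> win; have ij : w = i.+1 :> nat by move: si win; rewrite /supp wa /=; lia.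
apply/eqP; rewrite -subr_eq0; apply/eqP; apply: (@thin_edge_inj _ _ _ w) => //.
  by rewrite /supp wa /=; lia.
rewrite linearB; apply/eqP; rewrite subr_eq0; apply/eqP.
have := map_edge g w x; rewrite -fg map_edge; exact.
Qed.

(** Hom(L, S_a) is dual to the quotient of L_a by the image of the incoming arrow. *)
Lemma simple_map (a : 'I_n) L (h : 'Hom(L a, thin a false a)) :
  (forall i x, h (edge L i a x) = 0) -> exists g : morphism L (thin a false), g a = h.
Proof.
move=> h0; pose g : forall i, 'Hom(L i, thin a false i) := dfwith (fun i => 0) h.
have cg : commutes g.
  move=> i j ij x; rewrite /g; have [aj|aj] := eqVneq a j.
    subst j; rewrite dfwith_in dfwith_out ?h0 ?zero_lfunE ?linear0 //.
    by apply/eqP => /(congr1 val) /=; lia.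
  apply: etrans (esym _); apply: thin0; have : a != j :> nat by [].
    by rewrite /supp /=; lia.
  by rewrite /supp /=; lia.
by exists (morphism_of cg); rewrite /= /g dfwith_in.
Qed.

Lemma simple_map_unique (a : 'I_n) L (f g : morphism L (thin a false)) :
  f a = g a -> forall i, f i = g i.
Proof.
move=> fg i; have [<-//|ai] := eqVneq a i; apply/lfunP => x.
apply: etrans (esym _); apply: thin0; have : a != i :> nat by [].
  by rewrite /supp /=; lia.
by rewrite /supp /=; lia.
Qed.

(** * Projective modules are exact before the last vertex *)

Lemma projective_thin a : projective (thin a true).
Proof.
move=> X Y p f p_surj; have [an|na] := ltnP a n; last first.
  exists (zero_morphism _ _) => i; apply/lfunP => x.
  have -> : x = 0 by apply: thin0; have := ltn_ord i; rewrite /supp /=; lia.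
  by rewrite !linear0.
pose v := Ordinal an.
have /memv_imgP [x _ fx] : f v (gen a true v) \in limg (p v) by rewrite p_surj memvf.
have [g gx] := @projective_map v X x; exists g => i.
apply: (@projective_map_unique v _ (comp p g) f).
by rewrite /= comp_lfunE gx.
Qed.

(** The image of the arrow that ends at i, i.e. the component at i of the radical.
    The cyclic predecessor of vertex 0 is the last vertex, from which no arrow
    starts, so the inflow at 0 is zero. *)
Definition inflow M i : {vspace M i} := limg (edge M (ord_pred i) i).

Lemma mem_inflow M j i y : edge M j i y \in inflow M i.
Proof.
have [ij|ij] := eqVneq (nat_of_ord i) j.+1; last first.
  by rewrite (edge0 _ ij) zero_lfunE mem0v.
have jE : j = ord_pred i by apply: val_inj; rewrite /= ij addSn /= modnDr modn_small.
by subst j; apply: memv_img; apply: memvf.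
Qed.

Lemma inflowP M i x : x \in inflow M i -> exists j y, x = edge M j i y.
Proof. by move=> /memv_imgP[y _ ->]; exists (ord_pred i), y. Qed.

(** M has no cohomology at i: vectors killed by the outgoing arrow come from the
    incoming one. *)
Definition exact_vertex M i : Prop :=
  forall x : M i, (forall k, edge M i k x = 0) -> x \in inflow M i.

(** If x in P_i were killed by the outgoing arrow without lying in the radical, a
    morphism P -> S_i would be nonzero at x.  It would lift to P -> P_i, giving a
    nonzero vector of P_i at i that is killed by the arrow i -> i + 1, although this
    arrow of P_i is injective. *)
Lemma projective_exact P i : projective P -> (i.+1 < n)%N -> exact_vertex P i.
Proof.
move=> projP i1n x x0; apply: contraT => xU.
have dU (t : 'rV[F]_1) : ray 1 x t \in inflow P i -> ray 1 (gen i false i) t = 0.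
  rewrite !lfunE /= /ray_fun.
  have [-> |c0] := eqVneq (\sum_k t 0 k) 0; first by rewrite !scale0r.
  by rewrite rpredZeq (negPf c0) (negPf xU).
have [h [hx hU]] := factor_lfun dU.
have {}hx : h x = gen i false i.
  by have /lfunP/(_ (const_mx 1)) := hx; rewrite comp_lfunE !ray1 !scale1r.
have [f fh] : exists f : morphism P (thin i false), f i = h.
  by apply: simple_map => j y; apply/eqP; rewrite -memv_ker (subvP hU) ?mem_inflow.
have [p pi] := @projective_map i _ (gen i false i).
have p_surj : surjective_morphism p.
  move=> v; apply: limg_gen => sv.
  have vi : i = v by apply: ord_inj; move: sv; rewrite /supp /=; lia.
  by subst v; rewrite -pi memv_img ?memvf.
have [g pg] := projP _ _ p f p_surj.
pose j := Ordinal i1n.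
have gx0 : g i x = 0.
  apply: (@thin_edge_inj i true i j) => //; first by rewrite /supp /=; lia.
  by rewrite -map_edge x0 linear0.
have si : supp i false i by rewrite /supp /=; lia.
by have := gen_neq0 si; rewrite -hx -fh -pg comp_lfunE gx0 linear0 eqxx.
Qed.

(** * Vanishing of extensions *)

(** Exactness at M of L -> M -> N after dividing each module by its radical, at the
    vertex i.  Only the nontrivial inclusion is asked for. *)
Definition top_exact L M N (f : morphism L M) (g : morphism M N) i : Prop :=
  forall y : M i, g i y \in inflow N i -> y \in (limg (f i) + inflow M i)%VS.

Lemma top_exact_surjective L M N (f : morphism L M) (g : morphism M N) i :
  exact_at f g -> surjective_morphism g -> top_exact f g i.
Proof.
move=> fg g_surj y /inflowP[j [z gy]].
have /memv_imgP [z' _ zz'] : z \in limg (g j) by rewrite g_surj memvf.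
rewrite -(subrK (edge M j i z') y) memv_add ?mem_inflow // fg memv_ker.
by rewrite linearB /= map_edge -zz' gy subrr.
Qed.

(** The staircase: if y in L_i has g y = e z, with e the arrow into i, then e (h z) =
    h (g y) = 0, so exactness of N puts h z in the radical of N.  Top exactness one
    vertex earlier gives z = g w + (radical), hence g y = e (g w) = g (e w), and y - e w
    lies in the kernel of g, which is the image of f. *)
Lemma top_exact_step K L M N (f : morphism K L) (g : morphism L M)
    (h : morphism M N) i :
    exact_at f g -> exact_at g h ->
    (forall j, i = j.+1 :> nat -> exact_vertex N j /\ top_exact g h j) ->
  top_exact f g i.
Proof.
move=> fg gh prev y /inflowP[j [z gy]].
suff [w gyw] : exists w, g i (y - edge L j i w) = 0.
  by rewrite -(subrK (edge L j i w) y) memv_add ?mem_inflow // fg memv_ker gyw.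
have [ij|ij] := eqVneq (nat_of_ord i) j.+1; last first.
  by exists 0; rewrite linear0 subr0 gy (edge0 _ ij) zero_lfunE.
have [exN /(_ z)] := prev j ij.
case/(_ _)/memv_addP => [|_ /memv_imgP[w _ ->] [_ /inflowP[k [t ->]] zE]].
  apply: exN => k; have [ik|ik] := eqVneq (nat_of_ord k) j.+1; last first.
    by rewrite (edge0 _ ik) zero_lfunE.
  have -> : k = i by apply: val_inj; rewrite /= ik ij.
  rewrite -map_edge -gy; apply/eqP.
  by rewrite -memv_ker -gh memv_img ?memvf.
by exists w; rewrite linearB /= gy map_edge zE linearD /= edge_edge addr0 subrr.
Qed.

(** A cocycle R_(k+1) -> S_j is a linear form at j killing the radical and the image
    of the next differential.  By top exactness it factors through R_(k+1) -> R_k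
    modulo the radical, which is what a coboundary is. *)
Lemma Ext_simple_zero N (j : 'I_n) (k : nat) :
    (forall i, (i < j)%N -> exact_vertex N i) -> (1 <= k)%N ->
  Ext_zero k N (thin j false).
Proof.
case: k => [|k] exN k0 P f cf; first by [].
have resE l i : (i < j)%N -> exact_vertex (P l) i.
  move=> ij; apply: projective_exact; first exact: res_projective.
  by have := ltn_ord j; lia.
have top l :
    forall i, (i <= j)%N -> top_exact (res_diff P l.+1) (res_diff P l) i.
  elim: l => [|l IHl] i ij.
    apply: (top_exact_step (res_exact P 0) (res_exact_aug P)) => i' ii'; split.
      by apply: exN; lia.
    exact: top_exact_surjective (res_exact_aug P) (res_aug_surjective P).
  apply: (top_exact_step (res_exact P l.+1) (res_exact P l)) => i' ii'; split.
    by apply: resE; lia.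
  by apply: IHl; lia.
have fU x : res_diff P k j x \in inflow (P k) j -> f j x = 0.
  move=> /(top k j (leqnn j)).
  case/memv_addP=> [_ /memv_imgP[w _ ->] [_ /inflowP[i [t ->]] ->]].
  apply/eqP; rewrite -memv_ker rpredD // memv_ker.
    by rewrite -comp_lfunE cf zero_lfunE.
  rewrite map_edge; have [ij|ij] := eqVneq (nat_of_ord j) i.+1.
    by rewrite [f i t]thin0 ?linear0 // /supp /=; lia.
  by rewrite (edge0 _ ij) zero_lfunE.
have [h [hf hU]] := factor_lfun fU.
have [g gh] : exists g : morphism (P k) (thin j false), g j = h.
  by apply: simple_map => i y; apply/eqP; rewrite -memv_ker (subvP hU) ?mem_inflow.
exists g => i; apply: (@simple_map_unique j _ f (comp g (res_diff P k))).
by rewrite /= gh hf.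
Qed.

Lemma Ext_injective_zero N a (k : nat) :
  (a.+1 < n)%N -> (1 <= k)%N -> Ext_zero k N (thin a true).
Proof.
case: k => [|k] an k0 P f cf; first by [].
pose w := Ordinal an.
have f0 x : res_diff P k w x \in 0%VS -> f w x = 0.
  rewrite memv0 -memv_ker -res_exact => /memv_imgP[y _ ->].
  by rewrite -comp_lfunE cf zero_lfunE.
have [h [hf _]] := factor_lfun f0.
have [g gh] := @injective_map a w _ h erefl.
exists g => i; apply: (@injective_map_unique a w _ f (comp g (res_diff P k))) => //.
by rewrite /= gh hf.
Qed.

Lemma Hom_injective_zero N a (w : 'I_n) : w = a.+1 :> nat ->
  Hom_zero N (thin a true) <-> (fullv = 0%VS :> {vspace N w}).
Proof.
move=> wa; split=> [N0|N0 f i].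
  apply/eqP; rewrite -subv0; apply/subvP => x _; rewrite memv0.
  apply: contraT => x0.
  have sw : supp a true w by rewrite /supp wa /=; lia.
  have [h hx] := lfun_exists (gen a true w) x0.
  have [g gh] := @injective_map a w _ h wa.
  by have := gen_neq0 sw; rewrite -hx -gh N0 zero_lfunE eqxx.
apply: (@injective_map_unique a w _ f (zero_morphism _ _)) => //=.
apply/lfunP => x; rewrite zero_lfunE.
have : x \in fullv by apply: memvf.
by rewrite N0 memv0 => /eqP ->; rewrite linear0.
Qed.

Lemma Hom_projective_zero M (a : 'I_n) :
  Hom_zero (thin a true) M <-> (fullv = 0%VS :> {vspace M a}).
Proof.
split=> [M0|M0 f i].
  apply/eqP; rewrite -subv0; apply/subvP => x _.
  by have [g <-] := projective_map x; rewrite M0 zero_lfunE mem0v.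
apply: (@projective_map_unique a _ f (zero_morphism _ _)) => //=.
have : f a (gen a true a) \in fullv by apply: memvf.
by rewrite M0 memv0 zero_lfunE => /eqP ->.
Qed.

Lemma fullv_thin0 a e i : (fullv = 0%VS :> {vspace thin a e i}) <-> ~~ supp a e i.
Proof.
split=> [f0|/thin0 z].
  apply/negP => si; have : gen a e i \in fullv by apply: memvf.
  by rewrite f0 memv0 (negPf (gen_neq0 si)).
by apply/eqP; rewrite -subv0; apply/subvP => x _; rewrite [x]z mem0v.
Qed.

(** * Extensions between simple modules *)

Section GenMap.
Variables (a b : nat) (e e' : bool).
Hypothesis compat : forall v,
  supp a e v -> supp b e' v.+1 -> supp b e' v = supp a e v.+1.

Lemma edge_gen_compat i j : j = i.+1 :> nat -> supp a e i ->
  edge (thin b e') i j (gen b e' i) = (supp a e j)%:R *: gen b e' j.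
Proof.
move=> ij si; rewrite edge_gen //.
have [sj|/thin0 z] := boolP (supp b e' j); last by rewrite [LHS]z [RHS]z.
by congr ((nat_of_bool _)%:R *: _); rewrite ij compat // -ij.
Qed.

Definition gen_map : morphism (thin a e) (thin b e') := from_thin edge_gen_compat.

Lemma gen_mapE i : supp a e i -> gen_map i (gen a e i) = gen b e' i.
Proof. exact: from_thin_at_gen1. Qed.

End GenMap.

Lemma gen_map_exact a1 e1 a2 e2 a3 e3
    (f : morphism (thin a1 e1) (thin a2 e2))
    (g : morphism (thin a2 e2) (thin a3 e3)) :
    (forall i, supp a1 e1 i -> f i (gen a1 e1 i) = gen a2 e2 i) ->
    (forall i, supp a2 e2 i -> g i (gen a2 e2 i) = gen a3 e3 i) ->
    (forall i, supp a2 e2 i -> supp a1 e1 i = ~~ supp a3 e3 i) ->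
  exact_at f g.
Proof.
move=> fgen ggen s13 i; apply/eqP; rewrite eqEsubv; apply/andP; split.
  apply/subvP => _ /memv_imgP[x _ ->]; rewrite memv_ker; apply/eqP.
  have [s2|/thin0 z] := boolP (supp a2 e2 i); last by rewrite [f i x]z linear0.
  have [/thin0 z|s1] := boolP (~~ supp a1 e1 i); first by rewrite (z x) !linear0.
  by apply: thin0; rewrite -s13 // -[supp _ _ _]negbK.
apply/subvP => y; rewrite memv_ker => /eqP gy.
have [s2|/thin0 z] := boolP (supp a2 e2 i); last by rewrite (z y) mem0v.
have [c yE] := thin_gen y; have [s3|s3] := boolP (supp a3 e3 i).
  move: gy; rewrite yE linearZ /= ggen // => /eqP.
  by rewrite scaler_eq0 (negPf (gen_neq0 s3)) orbF => /eqP ->; rewrite scale0r mem0v.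
by rewrite yE -fgen ?s13 // memvZ // memv_img ?memvf.
Qed.

Lemma syzygy_compat a v :
  supp a.+1 true v -> supp a true v.+1 -> supp a true v = supp a.+1 true v.+1.
Proof. by rewrite /supp /=; lia. Qed.

Lemma cover_compat a v :
  supp a true v -> supp a false v.+1 -> supp a false v = supp a true v.+1.
Proof. by rewrite /supp /=; lia. Qed.

(** The minimal resolution ... -> P_(a+2) -> P_(a+1) -> P_a of S_a.  Its terms of index
    n - a and more are zero, and the thin module of index n - 1 is the simple
    projective at the last vertex. *)
Definition simple_resolution a : projective_resolution (thin a false).
Proof.
refine (@ProjectiveResolution F Q (thin a false) (fun k : nat => thin (k + a) true)
  (fun k : nat => gen_map (@syzygy_compat (k + a)))
  (gen_map (@cover_compat a)) _ _ _ _).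
- by move=> k; apply: projective_thin.
- move=> i; apply: limg_gen => si.
  have si' : supp a true i by move: si; rewrite /supp /=; lia.
  by rewrite -(gen_mapE (@cover_compat a) si') memv_img ?memvf.
- apply: gen_map_exact => i; [exact: gen_mapE..|]; rewrite /supp /=; lia.
- move=> k; apply: gen_map_exact => i; [exact: gen_mapE..|]; rewrite /supp /=; lia.
Defined.

(** For w = l + 1 + a, the projection P_w -> S_w is a cocycle for the minimal
    resolution of S_a; it is no coboundary as Hom(P_(w-1), S_w) = 0. *)
Lemma Ext_simple_nonzero a l : (l.+1 + a < n)%N ->
  ~ Ext_zero l.+1 (thin a false) (thin (l.+1 + a) false).
Proof.
move=> wn ext; pose w := Ordinal wn.
have [f fgen] := @projective_map w (thin w false) (gen w false w).
have cf : @cocycle F Q _ (simple_resolution a) (thin w false) l.+1 f.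
  move=> i; apply/lfunP => x; rewrite comp_lfunE zero_lfunE.
  have [wi|wi] := eqVneq w i.
    by rewrite [x]thin0 ?linear0 // -wi /supp /=; lia.
  by apply: thin0; have: w != i :> nat by []; rewrite /supp /=; lia.
have [g fg] := ext (simple_resolution a) f cf.
have un : (l + a < n)%N by lia.
have g0 : Hom_zero (thin (l + a) true) (thin w false).
  apply/(@Hom_projective_zero _ (Ordinal un)).
  by apply/fullv_thin0; rewrite /supp /=; lia.
have sw : supp w false w by rewrite /supp /=; lia.
by have := gen_neq0 sw; rewrite -fgen fg comp_lfunE (g0 g) zero_lfunE eqxx.
Qed.

(** * Invariance under isomorphism *)

Lemma isomorphic_sym M N : isomorphic M N -> isomorphic N M.
Proof. by case=> f [g fg]; exists g, f => i; have [] := fg i. Qed.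

(** For Ext, a resolution of N' becomes one of N, with the same terms, on composing
    its augmentation with N' -> N. *)
Lemma exceptional_pair_iso M M' N N' :
  isomorphic M M' -> isomorphic N N' ->
  exceptional_pair M N -> exceptional_pair M' N'.
Proof.
case=> u [u' uu'] [v [v' vv']] [hom0 ext0].
have uK i x : u i (u' i x) = x.
  by have [_ /lfunP/(_ x)] := uu' i; rewrite comp_lfunE id_lfunE.
have vK i x : v i (v' i x) = x.
  by have [_ /lfunP/(_ x)] := vv' i; rewrite comp_lfunE id_lfunE.
split=> [f i|[//|l] _ P f cf].
  apply/lfunP => x; rewrite zero_lfunE -[x]vK -[f i _]uK.
  have /lfunP/(_ (v' i x)) := hom0 (comp u' (comp f v)) i.
  by rewrite /= !comp_lfunE => ->; rewrite zero_lfunE linear0.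
have v'_surj : surjective_morphism (comp v' (res_aug P)).
  move=> i; apply/eqP; rewrite eqEsubv subvf; apply/subvP => x _.
  have /memv_imgP[y _ vx] : v i x \in limg (res_aug P i).
    by rewrite res_aug_surjective memvf.
  have [/lfunP/(_ x) vKx _] := vv' i; rewrite comp_lfunE id_lfunE in vKx.
  have -> : x = comp v' (res_aug P) i y by rewrite /= comp_lfunE -vx.
  by rewrite memv_img ?memvf.
have v'_exact : exact_at (res_diff P 0) (comp v' (res_aug P)).
  move=> i; rewrite (res_exact_aug P); apply/vspaceP => x.
  rewrite !memv_ker /= comp_lfunE; apply/eqP/eqP => [->|vx]; first by rewrite linear0.
  by rewrite -[res_aug P i x]vK vx linear0.
pose P' := ProjectiveResolution (@res_projective F Q N' P) v'_surj v'_exact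
  (@res_exact F Q N' P).
have cf' : @cocycle F Q _ P' M l.+1 (comp u' f).
  move=> i; apply/lfunP => x; have /lfunP/(_ x) := cf i.
  by rewrite /= !comp_lfunE !zero_lfunE => ->; rewrite linear0.
have [g fg] := ext0 l.+1 isT P' _ cf'.
exists (comp u g) => i; apply/lfunP => x; have /lfunP/(_ x) := fg i.
by rewrite /= !comp_lfunE => <-; rewrite uK.
Qed.

Lemma isomorphic_supp a e b e' i :
  isomorphic (thin a e) (thin b e') -> supp a e i -> supp b e' i.
Proof.
move=> [f [g fg]] si; apply: contraT => /thin0 z.
have [/lfunP/(_ (gen a e i)) + _] := fg i; rewrite comp_lfunE id_lfunE [f i _]z linear0.
by have := gen_neq0 si => /eqP + /esym.
Qed.

Lemma isomorphic_thin a (e : bool) b (e' : bool) : (a + e < n)%N -> (b + e' < n)%N ->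
  isomorphic (thin a e) (thin b e') -> (a, e) = (b, e').
Proof.
move=> an bn iso.
have sE v : (v < n)%N -> supp a e v = supp b e' v.
  move=> vn; apply/idP/idP; first exact: (@isomorphic_supp _ _ _ _ (Ordinal vn)).
  exact: (@isomorphic_supp _ _ _ _ (Ordinal vn) (isomorphic_sym iso)).
have a0 : (a < n)%N by lia.
have b0 : (b < n)%N by lia.
move: (sE _ an) (sE _ bn) (sE _ a0) (sE _ b0); rewrite /supp.
by clear sE iso; case: e an; case: e' bn => /= *; congr (_, _); lia.
Qed.

(** * Indecomposable modules *)

Lemma submodule_edge M (U : forall i : Q, {vspace M i}) i j x :
  submodule U -> x \in U i -> edge M i j x \in U j.
Proof.
move=> sU xU; have [ij|ij] := eqVneq (nat_of_ord j) i.+1; last first.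
  by rewrite (edge0 _ ij) zero_lfunE mem0v.
by rewrite -(edgeE _ ij) (subvP (sU i j ij)) ?memv_img.
Qed.

Lemma submodule_limg M N (f : morphism M N) : submodule (fun i : Q => limg (f i)).
Proof.
move=> i j ij; apply/subvP => _ /memv_imgP[_ /memv_imgP[x _ ->] ->].
by rewrite edgeE -map_edge memv_img ?memvf.
Qed.

Lemma submodule_lker M N (f : morphism M N) : submodule (fun i : Q => lker (f i)).
Proof.
move=> i j ij; apply/subvP => _ /memv_imgP[x fx ->].
rewrite edgeE memv_ker map_edge; move: fx; rewrite memv_ker => /eqP ->.
by rewrite linear0.
Qed.

(** A retract T of M is a direct summand: M is the sum of the image of s and the
    kernel of r. *)
Lemma retract_isomorphic M T (s : morphism T M) (r : morphism M T) i0 :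
    indecomposable M -> (forall i, (r i \o s i)%VF = \1%VF) ->
    (fullv != 0%VS :> {vspace T i0}) ->
  isomorphic M T.
Proof.
move=> [_ indM] rs T0.
have rK i x : r i (s i x) = x.
  by have /lfunP/(_ x) := rs i; rewrite comp_lfunE id_lfunE.
have [i|s0|r0] := indM _ _ (submodule_limg s) (submodule_lker r).
- split.
    apply/eqP; rewrite eqEsubv subvf /=; apply/subvP => x _.
    rewrite -(subrK (s i (r i x)) x) addrC memv_add ?memv_img ?memvf // memv_ker.
    by rewrite linearB /= rK subrr.
  apply/eqP; rewrite -subv0; apply/subvP => x; rewrite memv_cap => /andP[].
  by case/memv_imgP => y _ ->; rewrite memv_ker rK => /eqP ->; rewrite linear0 mem0v.
- case/eqP: T0; apply/eqP; rewrite -subv0; apply/subvP => x _.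
  have /eqP sx : s i0 x == 0 by rewrite -memv0 -(s0 i0) memv_img ?memvf.
  by rewrite -[x]rK sx linear0 mem0v.
exists r, s => i; split; last by rewrite rs.
apply/lfunP => x; rewrite comp_lfunE id_lfunE; apply/eqP.
by rewrite -subr_eq0 -memv0 -(r0 i) memv_ker linearB /= rK subrr.
Qed.

(** If some arrow v -> w does not kill y, then y spans a copy of P_v that is a retract
    of M: extend to M the linear form that is 1 on the image of y at w, P_v being
    injective.  If all arrows vanish, every linear map M_v -> F is a morphism
    M -> S_v. *)
Lemma indecomposable_isomorphic M : indecomposable M ->
  exists a (e : bool), (a + e < n)%N /\ isomorphic M (thin a e).
Proof.
move=> indM; have [|] := boolP [exists i, exists j, edge M i j != 0].
  case/existsP => v /existsP[w vw0].
  have vw : w = v.+1 :> nat.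
    by apply/eqP; apply: contraT => /(edge0 M) vw; rewrite vw eqxx in vw0.
  have [y yn0] : exists y, edge M v w y != 0.
    have /subvPn[y _ yn] : ~~ (fullv <= lker (edge M v w))%VS; last first.
      by exists y; rewrite -memv_ker.
    apply: contra vw0 => /subvP k; apply/eqP/lfunP => y; apply/eqP.
    by rewrite zero_lfunE -memv_ker k ?memvf.
  have [s sy] := projective_map y.
  have [h hy] := lfun_exists (gen v true w) yn0.
  have [r rh] := @injective_map v w M h vw.
  have sv : supp v true v by rewrite /supp /=; lia.
  exists v, true; split; first by have := ltn_ord w; rewrite vw addn1.
  apply: (@retract_isomorphic M _ s r v) => //; last first.
    by apply/eqP => /fullv_thin0; rewrite sv.
  move=> i; have idc : commutes (fun i => \1%VF : 'Hom(thin v true i, thin v true i)).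
    by move=> j k _ x; rewrite !id_lfunE.
  apply: (@injective_map_unique v w _ (comp r s) (morphism_of idc) vw).
  apply: eq_on_gen; rewrite /= comp_lfunE id_lfunE rh.
  have sw : s w (gen v true w) = edge M v w y.
    by rewrite -(edge_gen1 vw sv) map_edge sy.
  by rewrite sw.
rewrite negb_exists => /forallP M0.
have {}M0 i j x : edge M i j x = 0.
  have := M0 i; rewrite negb_exists => /forallP/(_ j); rewrite negbK => /eqP ->.
  by rewrite zero_lfunE.
have [v Mv] := indM.1.
have y0 : vpick {:M v} != 0 by rewrite vpick0 -dimv_eq0.
set y := vpick _ in y0.
have [h hy] := lfun_exists (gen v false v) y0.
have [r rh] : exists r : morphism M (thin v false), r v = h.
  by apply: simple_map => j x; rewrite M0 linear0.
pose z : forall i, M i := dfwith (fun i => 0) y.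
have Hz i j : j = i.+1 :> nat -> supp v false i ->
    edge M i j (z i) = (supp v false j)%:R *: z j.
  move=> ij si; rewrite M0 (_ : supp _ _ _ = false) ?scale0r //.
  by move: si; rewrite /supp ij /=; lia.
have sv : supp v false v by rewrite /supp /=; lia.
exists v, false; split; first by rewrite addn0.
apply: (@retract_isomorphic M _ (from_thin Hz) r v) => //; last first.
  by apply/eqP => /fullv_thin0; rewrite sv.
have idc : commutes (fun i => \1%VF : 'Hom(thin v false i, thin v false i)).
  by move=> j k _ x; rewrite !id_lfunE.
apply: (@simple_map_unique v _ (comp r (from_thin Hz)) (morphism_of idc)).
apply: eq_on_gen; rewrite /= comp_lfunE id_lfunE from_thin_at_gen1 //.
by rewrite /z dfwith_in rh.
Qed.

(** At the first vertex v = a one of two complementary submodules is all of the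
    one-dimensional space, hence contains the generator of the module. *)
Lemma thin_indecomposable a (e : bool) : (a + e < n)%N -> indecomposable (thin a e).
Proof.
move=> an; have vn : (a < n)%N by lia.
pose v := Ordinal vn; have sv : supp a e v by rewrite /supp /=; lia.
split; first by exists v; rewrite dimv_eq0; apply/eqP => /fullv_thin0; rewrite sv.
have half (U W : forall i : Q, {vspace thin a e i}) : submodule U ->
    (forall i, (U i + W i)%VS = fullv /\ (U i :&: W i)%VS = 0%VS) ->
    W v = 0%VS -> zero_submodule W.
  move=> sU UW Wv i; have [UWi capi] := UW i; have [UWv _] := UW v.
  have gU : gen a e i \in U i; last first.
    rewrite -capi; apply/esym/capv_idPr/subvP => x _.
    by have [c ->] := thin_gen x; apply: memvZ.
  have gv : gen a e v \in U v by move: UWv; rewrite Wv addv0 => ->; apply: memvf.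
  have [vi|vi] := eqVneq v i; first by subst i.
  have [si|/thin0 z] := boolP (supp a e i); last by rewrite [gen _ _ _]z mem0v.
  have vi' : v != i :> nat by [].
  have iv : i = v.+1 :> nat by move: si vi'; rewrite /supp /=; case: (e) => /=; lia.
  by rewrite -(edge_gen1 iv sv) submodule_edge.
move=> U W sU sW UW; have [UWv capv] := UW v.
have [U0|U0] := eqVneq (U v) 0%VS.
  by left; apply: half sW _ U0 => i; rewrite addvC capvC.
right; apply: half sU UW _.
have gU : gen a e v \in U v.
  have : vpick (U v) != 0 by rewrite vpick0.
  have := memv_pick (U v); have [c ->] := thin_gen (vpick (U v)).
  by rewrite rpredZeq scaler_eq0; case: eqP => //=.
rewrite -capv; apply/esym/capv_idPr/subvP => x _.
by have [c ->] := thin_gen x; apply: memvZ.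
Qed.

(** * Exceptional pairs of thin modules *)

Definition exceptional_thin a (e : bool) b (e' : bool) : bool :=
  if e then ~~ supp b e' a.+1 else if e' then a != b else (a < b)%N.

Lemma exceptional_thinP a (e : bool) b (e' : bool) : (a + e < n)%N -> (b + e' < n)%N ->
  exceptional_pair (thin a e) (thin b e') <-> exceptional_thin a e b e'.
Proof.
rewrite /exceptional_thin; case: e => an bn.
  have wn : (a.+1 < n)%N by lia.
  have H := Hom_injective_zero (thin b e') (erefl : Ordinal wn = a.+1 :> nat).
  split=> [[/H/fullv_thin0 //]|sw]; split; first exact/H/fullv_thin0.
  by move=> k k0; apply: Ext_injective_zero.
have an' : (a < n)%N by lia.
have bn' : (b < n)%N by lia.
case: e' bn => bn.
  have H : Hom_zero (thin b true) (thin a false) <-> (a != b).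
    have E := @Hom_projective_zero (thin a false) (Ordinal bn').
    have E' := @fullv_thin0 a false (Ordinal bn').
    split=> [/E/E'|ab]; first by rewrite /supp /=; lia.
    by apply/E/E'; rewrite /supp /=; lia.
  split=> [[/H //]|ab]; split; first exact/H.
  move=> k; apply: (@Ext_simple_zero _ (Ordinal an')) => i _ x x0.
  have [ib|ib] := eqVneq (nat_of_ord i) b.
    have wn : (i.+1 < n)%N by lia.
    rewrite (@thin_edge_inj b true i (Ordinal wn) x) ?mem0v // /supp /= ib; lia.
  have [si|/thin0 z] := boolP (supp b true i); last by rewrite [x]z mem0v.
  have iE : i = (Ordinal bn').+1 :> nat by move: si ib; rewrite /supp /=; lia.
  have := @thin_edge_surj b true (Ordinal bn') i x iE.
  rewrite /supp leqnn leq_addr => /(_ isT)/memv_imgP[y _ ->]; exact: mem_inflow.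
split=> [[hom0 ext0]|ab].
  case: (ltngtP a b) => // [ba|ab].
    have aE : ((a - b).-1.+1 + b)%N = a by lia.
    case: (@Ext_simple_nonzero b (a - b).-1); first by lia.
    by rewrite aE; apply: ext0.
  have idc : commutes (fun i => \1%VF : 'Hom(thin a false i, thin a false i)).
    by move=> j k _ x; rewrite !id_lfunE.
  have sa : supp a false (Ordinal an') by rewrite /supp /=; lia.
  rewrite -ab in hom0.
  have /lfunP/(_ (gen a false _)) := hom0 (morphism_of idc) (Ordinal an').
  by rewrite /= id_lfunE zero_lfunE => /eqP; rewrite (negPf (gen_neq0 sa)).
split=> [f i|k].
  apply/lfunP => x; have [/thin0 z|si] := boolP (~~ supp b false i).
    by rewrite [x]z !linear0.
  apply: etrans (esym _); apply: thin0; move: si; rewrite /supp /=; lia.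
apply: (@Ext_simple_zero _ (Ordinal an')) => i ia x _.
by rewrite [x]thin0 ?mem0v //; move: ia; rewrite /supp /=; lia.
Qed.

End Modules.

(** * Counting *)

Lemma sum_neq (k c : nat) : (\sum_(b < k) (b != c :> nat) + (c < k) = k)%N.
Proof.
elim: k => [|k]; first by rewrite big_ord0.
by rewrite big_ord_recr /=; set S := (\sum_(_ < _) _)%N; lia.
Qed.

Lemma sum_neq2 (k c : nat) :
  (\sum_(b < k) ((b != c :> nat) && (b != c.+1 :> nat)) + (c < k) + (c.+1 < k) = k)%N.
Proof.
elim: k => [|k]; first by rewrite big_ord0.
by rewrite big_ord_recr /=; set S := (\sum_(_ < _) _)%N; lia.
Qed.

Lemma sum_ltn k c : (c <= k -> \sum_(a < k) (a < c) = c)%N.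
Proof.
move=> ck; rewrite -(subnK ck); move: (k - c)%N => d.
elim: d => [|d IHd].
  by rewrite (eq_bigr (fun=> 1%N)) ?sum1_card ?card_ord // => i _; rewrite ltn_ord.
by rewrite addSn big_ord_recr /= IHd; lia.
Qed.

Lemma double_sum_ord k : (2 * \sum_(b < k) b + k = k ^ 2)%N.
Proof.
elim: k => [|k]; first by rewrite big_ord0.
by rewrite big_ord_recr /=; set S := (\sum_(_ < _) _)%N; lia.
Qed.

Definition exceptional_index n : {set ('I_n * bool) * ('I_n * bool)} :=
  [set p : ('I_n * bool) * ('I_n * bool) | [&& p.1.1 + p.1.2 < n, p.2.1 + p.2.2 < n
             & exceptional_thin p.1.1 p.1.2 p.2.1 p.2.2]%N].

Lemma card_exceptional_index_sum n :
  (#|exceptional_index n| =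
   \sum_(a < n) \sum_(e : bool) \sum_(b < n) \sum_(e' : bool)
   [&& a + e < n, b + e' < n & exceptional_thin a e b e'])%N.
Proof.
rewrite -sum1dep_card big_mkcond /=.
rewrite [RHS](pair_bigA _ (fun (a : 'I_n) (e : bool) =>
   \sum_(b < n) \sum_(e' : bool)
     [&& a + e < n, b + e' < n & exceptional_thin a e b e'])%N).
under [RHS]eq_bigr => x _ do
  rewrite (pair_bigA _ (fun (b : 'I_n) (e' : bool) => nat_of_bool
    [&& x.1 + x.2 < n, b + e' < n & exceptional_thin x.1 x.2 b e'])%N).
by rewrite pair_bigA; apply: eq_bigr => p _; case: ifP.
Qed.

(** With n = m + 1, the pairs (M, N) are counted by type, T standing for some P_a and
    F for some S_a: TT = m^2 - m - (m - 1), TF = FT = m^2 and FF = m (m + 1) / 2. *)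
Lemma card_exceptional_index n :
  (2 <= n -> 2 * #|exceptional_index n| + 17 * n = 7 * n ^ 2 + 12)%N.
Proof.
case: n => [|m] // m1; rewrite card_exceptional_index_sum.
under eq_bigr => a _.
  rewrite big_bool /=.
  under eq_bigr => b _ do rewrite big_bool /=.
  under [in X in (_ + X)%N]eq_bigr => b _ do rewrite big_bool /=.
  rewrite !big_split /=.
  over.
rewrite !big_split /=.
set TT := (\sum_i _)%N; set TF := (X in (_ + X + _)%N).
set FT := (X in (_ + (X + _))%N); set FF := (X in (_ + (_ + X))%N).
have FFE : (2 * FF + m.+1 = m.+1 ^ 2)%N.
  rewrite -[RHS]double_sum_ord /FF exchange_big /=; congr (2 * _ + _)%N.
  apply: eq_bigr => b _; rewrite -[RHS](@sum_ltn m.+1) ?(ltnW (ltn_ord b)) //.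
  apply: eq_bigr => a _; have := ltn_ord a; have := ltn_ord b.
  by rewrite !addn0 => -> ->.
have FTE : (FT = m ^ 2)%N.
  rewrite /FT exchange_big /= big_ord_recr /= [X in (_ + X)%N]big1 ?addn0; last first.
    by move=> a _; rewrite addn1 ltnn andbF.
  rewrite (eq_bigr (fun=> m)) ?sum_nat_const ?card_ord // => b _.
  have := sum_neq m.+1 b; rewrite ltnS ltnW ?ltn_ord // [(_ + true)%N]addn1.
  move=> -[E]; rewrite /= -[RHS]E.
  apply: eq_bigr => a _; have := ltn_ord a; have := ltn_ord b.
  by rewrite addn0 addn1 !ltnS => -> ->.
have TFE : (TF = m ^ 2)%N.
  rewrite /TF big_ord_recr /= [X in (_ + X)%N]big1 ?addn0; last first.
    by move=> a _; rewrite addn1 ltnn.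
  rewrite (eq_bigr (fun=> m)) ?sum_nat_const ?card_ord // => a _.
  have := sum_neq m.+1 a.+1; rewrite ltnS ltn_ord [(_ + true)%N]addn1.
  move=> -[E]; rewrite /= -[RHS]E.
  apply: eq_bigr => b _; have := ltn_ord a; have := ltn_ord b.
  by rewrite /supp /=; lia.
have TTE : (TT + m + m.-1 = m ^ 2)%N.
  rewrite /TT big_ord_recr /= [X in (_ + X + m + _)%N]big1 ?addn0; last first.
    by move=> a _; rewrite addn1 ltnn.
  pose row a :=
    (\sum_(b < m.+1) [&& a + 1 < m.+1, b + 1 < m.+1 & ~~ supp b true a.+1])%N.
  have inner (a : 'I_m) : (row a + 1 + (a.+1 < m) = m)%N.
    rewrite -[RHS](sum_neq2 m a) ltn_ord; congr (_ + _ + _)%N.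
    rewrite /row big_ord_recr /= [X in (_ + nat_of_bool X)%N](_ : _ = false).
      rewrite addn0; apply: eq_bigr => b _; have := ltn_ord a; have := ltn_ord b.
      by rewrite /supp /=; lia.
    by rewrite !addn1 ltnn andbF.
  have : (\sum_(a < m) (row a + 1 + (a.+1 < m)) = \sum_(a < m) m)%N.
    by apply: eq_bigr => a _; apply: inner.
  rewrite !big_split /= !sum_nat_const card_ord muln1 -mulnn => <-; congr (_ + _ + _)%N.
  case: (m) m1 => // k _; rewrite big_ord_recr /= ltnn addn0.
  by rewrite (eq_bigr (fun=> 1%N)) ?sum1_card ?card_ord // => i _; rewrite ltnS ltn_ord.
nia.
Qed.

Lemma number_of_exceptional_pairs_card (F : fieldType) n :
  number_of_exceptional_pairs F (linear_quiver n) #|exceptional_index n|.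
Proof.
pose T (x : 'I_n * bool) : module F (linear_quiver n) := thin F n x.1 x.2.
have valid (a : 'I_#|exceptional_index n|) (p := enum_val a) :
    [&& p.1.1 + p.1.2 < n, p.2.1 + p.2.2 < n
      & exceptional_thin p.1.1 p.1.2 p.2.1 p.2.2]%N.
  by have := @enum_valP _ (mem (exceptional_index n)) a; rewrite /= inE.
exists (fun a => (T (enum_val a).1, T (enum_val a).2)); split.
- move=> a; have /and3P[v1 v2 ex] := valid a.
  by split; [exact: thin_indecomposable..|exact/exceptional_thinP].
- move=> a b /= iso1 iso2.
  have /and3P[a1 a2 _] := valid a; have /and3P[b1 b2 _] := valid b.
  apply: enum_val_inj; move: (enum_val a) (enum_val b) a1 a2 b1 b2 iso1 iso2.
  move=> [[i e] [j d]] [[i' e'] [j' d']] /= a1 a2 b1 b2 iso1 iso2.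
  have [/val_inj -> ->] := isomorphic_thin a1 b1 iso1.
  by have [/val_inj -> ->] := isomorphic_thin a2 b2 iso2.
move=> M N indM indN exMN.
have [a [e [ae isoM]]] := indecomposable_isomorphic indM.
have [b [d [bd isoN]]] := indecomposable_isomorphic indN.
have an : (a < n)%N by lia.
have bn : (b < n)%N by lia.
have p_in : ((Ordinal an, e), (Ordinal bn, d)) \in exceptional_index n.
  rewrite inE /= ae bd; apply/(exceptional_thinP F ae bd).
  exact: exceptional_pair_iso exMN.
exists (enum_rank_in p_in ((Ordinal an, e), (Ordinal bn, d))).
by rewrite enum_rankK_in.
Qed.

Unset Implicit Arguments.

Theorem theorem5p3 (F : closedFieldType) (n : nat) (hn : (3 <= n)%N) :
  exists m : nat,
    number_of_exceptional_pairs F (linear_quiver n) m /\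
    (m%:R : rat) = (7 * n%:R ^+ 2 - 17 * n%:R + 12) / 2.
Proof.
exists #|exceptional_index n|; split; first exact: number_of_exceptional_pairs_card.
have /(congr1 (fun k : nat => k%:R : rat)) := card_exceptional_index (ltnW hn).
by rewrite !natrD !natrM expr2 => E; lra.
Qed.
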